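(* For every integer $n\ge 1$, the friendship graph $F_n$ is not an MPF graph.
   Context: The friendship graph $F_n$ is the graph on $2n+1$ vertices constructed by joining $n$ copies of the triangle $C_3$ at one common vertex. All graphs are finite. A simple graph is an undirected graph without loops or multiple edges. A labeling of a graph on $N$ vertices is a bijection from its vertex set to $\{1,\ldots,N\}$; it determines the adjacency matrix $A(\cdot)$. A simple graph $X$ on $N$ vertices is an MPF (matrix product factorizable) graph if there exist simple graphs $G$ and $H$ on $N$ vertices and labelings of $G$, $H$ and $X$ such that, with respect to these labelings, $A(G)A(H)=A(X)$. *)

(* Defs.v *)
From mathcomp Require Import all_boot all_order all_algebra.

Set Implicit Arguments.
Unset Strict Implicit.
Unset Printing Implicit Defensive.

Import GRing.Theory.
Local Open Scope ring_scope.

Record sgraph := SGraph {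
  vertex :> finType;
  edge : rel vertex;
  edge_sym : symmetric edge;
  edge_irr : irreflexive edge
}.

(* The label set {1, ..., N} is rendered as 'I_N = {0, ..., N - 1}.  The inverse
   bijection is stored because the adjacency matrix is read through it. *)
Record labeling (G : sgraph) (N : nat) := Labeling {
  label :> G -> 'I_N;
  unlabel : 'I_N -> G;
  labelK : cancel label unlabel;
  unlabelK : cancel unlabel label
}.

Definition adjmx (G : sgraph) (N : nat) (l : labeling G N) : 'M[int]_N :=
  \matrix_(i, j) (edge (unlabel l i) (unlabel l j))%:R.

(* A labeling of G by 'I_#|X| can exist only if #|G| = #|X|, and likewise for
   H, so the orders of G and H need no separate hypothesis. *)
Definition MPF (X : sgraph) : Prop :=
  exists (G H : sgraph)
         (lG : labeling G #|X|) (lH : labeling H #|X|) (lX : labeling X #|X|),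
    adjmx lG *m adjmx lH = adjmx lX.

(* None is the common vertex; Some (i, b), with b a boolean, are the two other
   vertices of the i-th triangle. *)
Definition friendship_edge (n : nat) : rel (option ('I_n * bool)) :=
  fun x y =>
    match x, y with
    | None, None => false
    | None, Some _ | Some _, None => true
    | Some (i, b), Some (j, c) => (i == j) && (b != c)
    end.

Lemma friendship_edge_sym n : symmetric (@friendship_edge n).
Proof.
by move=> [[i b]|] [[j c]|] //=; rewrite [i == j]eq_sym [b == c]eq_sym.
Qed.

Lemma friendship_edge_irr n : irreflexive (@friendship_edge n).
Proof. by move=> [[i b]|] //=; rewrite !eqxx. Qed.

Definition friendship (n : nat) : sgraph :=
  SGraph (@friendship_edge_sym n) (@friendship_edge_irr n).

Lemma card_friendship n : #|friendship n| = (2 * n + 1)%N.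
Proof.
by rewrite /= card_option card_prod card_ord card_bool mulnC addn1.
Qed.

(* Main.v *)
Require Import Defs.
From mathcomp Require Import all_boot all_order all_algebra.
From mathcomp Require Import zify.

(** Suppose [A(G) A(H) = A(X)].  As [A(X)] is symmetric, [A(G)] and [A(H)]
    commute, so two vertices are adjacent in [X] exactly when they are joined
    by a path made of a [G]-edge followed by an [H]-edge, and then also by one
    made of an [H]-edge followed by a [G]-edge; both paths are unique.
    Double counting shows that the [H]-degree is constant along [G]-edges
    ([degree_along_edge]), and hence that the degrees multiply:
    [deg_X v = deg_G v * deg_H v] ([degree_mul]).

    For [X] the friendship graph, a vertex other than the centre [c] has
    degree 2, so its pair of degrees is (1, 2) or (2, 1).  The centre has a
    [G]-neighbour and an [H]-neighbour; comparing degrees along these edges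
    gives [deg_H c <= 2] and [deg_G c <= 2], and therefore [2 n <= 4].
    - If [n = 1], the neighbourhoods of [c] in [G] and [H] have total size
      1 + 2.  They are disjoint and avoid [c], because [A(X)] has zero
      diagonal ([degree_add_lt]); but there are only 3 vertices.
    - If [n = 2], then [c] has degrees (2, 2), so its [G]-neighbours have
      degrees (1, 2) and its [H]-neighbours have degrees (2, 1).  The set of
      vertices of [G]-degree 1 is closed under [H]-adjacency, so it contains a
      vertex together with its two [H]-neighbours and has at least 3 elements
      ([card_degree_class]).  The same holds for the vertices of [H]-degree 1.
      The two sets are disjoint, but there are only 5 vertices. *)

Set Implicit Arguments.
Unset Strict Implicit.
Unset Printing Implicit Defensive.

(** The equation [A(G) A(H) = A(X)] for graphs on a common vertex set, with the
    matrix product read as a count of paths. *)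
Record factorization (T : finType) (g h x : rel T) : Prop := Factorization {
  fact_symL : symmetric g;
  fact_symR : symmetric h;
  fact_sym : symmetric x;
  fact_irrL : irreflexive g;
  fact_irrR : irreflexive h;
  fact_irr : irreflexive x;
  fact_paths : forall i j, \sum_k (g i k * h k j) = x i j
}.

(** Transposing the equation exchanges the factors, so each lemma below also
    yields its mirror image. *)
Lemma factorizationC (T : finType) (g h x : rel T) :
  factorization g h x -> factorization h g x.
Proof.
case=> sg sh sx ig ih ix paths; split=> // i j.
rewrite sx -paths; apply: eq_bigr => k _.
by rewrite mulnC (sg k) (sh i).
Qed.

Lemma card_rel_sum (T : finType) (e : rel T) i : #|e i| = \sum_j e i j.
Proof.
rewrite -sum1_card big_mkcond; apply: eq_bigr => j _.
by rewrite unfold_in; case: (e i j).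
Qed.

Section Degrees.

Variables (T : finType) (g h x : rel T).
Hypothesis fact : factorization g h x.

(** If [i] and [k] are [G]-adjacent, every [H]-neighbour [a] of [i] is
    [X]-adjacent to [k] through [i], hence also through some [b] with
    [H k b] and [G b a].  Exchanging the two sums, each such [b] is hit at most
    once, because [i] and [b] are joined by at most one path. *)
Lemma degree_along_edge_le i k : g i k -> #|h i| <= #|h k|.
Proof.
move=> gik; have factC := factorizationC fact.
rewrite card_rel_sum [leqRHS]card_rel_sum.
have xka a : h i a -> x k a = 1 :> nat.
  move=> hia; have := fact_paths fact k a.
  rewrite (bigD1 i) //= (fact_symL fact k i) gik hia.
  by case: (x k a) => //; lia.
have -> : \sum_a h i a = \sum_a \sum_b h i a * (h k b * g b a).
  apply: eq_bigr => a _; rewrite -big_distrr /= (fact_paths factC).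
  by case hia: (h i a); rewrite ?mul0n // xka.
rewrite exchange_big /=; apply: leq_sum => b _.
have -> : \sum_a h i a * (h k b * g b a) = h k b * x i b.
  rewrite -(fact_paths factC) big_distrr /=; apply: eq_bigr => a _.
  by rewrite (fact_symL fact b) mulnCA.
by case: (h k b) (x i b) => [] [].
Qed.

Lemma degree_along_edge i k : g i k -> #|h i| = #|h k|.
Proof.
move=> gik; apply/eqP; rewrite eqn_leq !degree_along_edge_le //.
by rewrite (fact_symL fact).
Qed.

(** Row [i] of the product sums to the number of paths leaving [i], and all the
    [G]-neighbours of [i] have the [H]-degree of [i]. *)
Lemma degree_mul i : #|x i| = #|g i| * #|h i|.
Proof.
rewrite card_rel_sum (eq_bigr _ (fun j _ => esym (fact_paths fact i j))).
rewrite exchange_big /= (card_rel_sum g) big_distrl /=; apply: eq_bigr => k _.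
rewrite -big_distrr -card_rel_sum /=.
by case gik: (g i k); rewrite ?mul0n // (degree_along_edge gik).
Qed.

(** A common neighbour of [i] in [G] and [H] would be a path from [i] to itself,
    that is, a loop of [X]. *)
Lemma degree_add_lt i : #|g i| + #|h i| < #|T|.
Proof.
have dis : [disjoint g i & h i].
  apply/pred0P => k /=; apply/negP => /andP[].
  rewrite !unfold_in => gik hik; have := fact_paths fact i i.
  by rewrite (bigD1 k) //= (fact_symR fact k) gik hik (fact_irr fact).
have /eqP <- : #|[predU g i & h i]| == #|g i| + #|h i|.
  by rewrite -cardUI (eq_card0 (pred0P dis)) addn0.
apply: (@leq_trans #|[predU1 i & [predU g i & h i]]|); last exact: max_card.
rewrite cardU1 [i \in _]inE /= !unfold_in.
by rewrite (fact_irrL fact) (fact_irrR fact).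
Qed.

End Degrees.

(** The class contains [i] and all its [H]-neighbours, because the [G]-degree is
    constant along [H]-edges. *)
Lemma card_degree_class (T : finType) (g h x : rel T) i :
  factorization g h x -> #|h i| < #|[pred v | #|g v| == #|g i|]|.
Proof.
move=> fact.
apply: (@leq_trans #|[predU1 i & h i]|).
  by rewrite cardU1 unfold_in (fact_irrR fact).
apply/subset_leq_card/subsetP => v; rewrite !inE => /predU1P[-> //|hiv].
by rewrite (degree_along_edge (factorizationC fact) hiv).
Qed.

(** The edges of [G] and [H], pulled back along the labels, give relations on the
    vertices of [X], so that labelings disappear from the rest of the proof. *)
Lemma MPF_factorization (X : sgraph) :
  MPF X -> exists g h : rel X, factorization g h (@edge X).
Proof.
move=> [G [H [lG [lH [lX eqGH]]]]].
exists (fun u v => edge (unlabel lG (lX u)) (unlabel lG (lX v))).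
exists (fun u v => edge (unlabel lH (lX u)) (unlabel lH (lX v))).
split=> [u v|u v|||||i j]; try exact: edge_sym; try by move=> u; apply: edge_irr.
have /matrixP/(_ (lX i) (lX j)) := eqGH; rewrite !mxE !labelK.
rewrite (eq_bigr (fun k => (edge (unlabel lG (lX i)) (unlabel lG k) *
          edge (unlabel lH k) (unlabel lH (lX j)))%:R)%R); last first.
  by move=> k _; rewrite !mxE GRing.natrM.
rewrite -GRing.natr_sum => /eqP; rewrite Num.Theory.eqr_nat => /eqP <-.
rewrite [RHS](reindex (label lX)) //.
by exists (unlabel lX) => k _; rewrite ?labelK ?unlabelK.
Qed.

Lemma card_friendship_center n : #|@friendship_edge n None| = 2 * n.
Proof.
have := cardC1 (None : option ('I_n * bool)).
rewrite card_option card_prod card_ord card_bool /= mulnC => <-.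
by apply: eq_card => -[[i b]|]; rewrite !inE.
Qed.

Lemma card_friendship_rim n (p : 'I_n * bool) :
  #|@friendship_edge n (Some p)| = 2.
Proof.
case: p => i b.
transitivity #|pred2 None (Some (i, ~~ b))|; last by rewrite card2.
apply: eq_card => -[[j c]|]; rewrite !inE // unfold_in /=.
rewrite (inj_eq Some_inj) xpair_eqE eq_sym.
by case: b c => [] [].
Qed.

Section FriendshipFactorization.

Variables (n : nat) (g h : rel (option ('I_n * bool))).
Hypothesis fact : factorization g h (@friendship_edge n).

Lemma rim_degrees p :
  #|g (Some p)| = 1 /\ #|h (Some p)| = 2 \/
  #|g (Some p)| = 2 /\ #|h (Some p)| = 1.
Proof.
have := degree_mul fact (Some p); rewrite card_friendship_rim.
by case: #|g _| => [|[|[|a]]]; case: #|h _| => [|[|[|b]]]; lia.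
Qed.

(** This is what bounds the degrees of the centre: those of a rim vertex are at
    most 2. *)
Lemma center_degree : 0 < #|g None| ->
  exists2 p, g None (Some p) & #|h None| = #|h (Some p)|.
Proof.
case/card_gt0P => -[p|]; rewrite unfold_in => gp.
  by exists p => //; apply: (degree_along_edge fact).
by rewrite (fact_irrL fact) in gp.
Qed.

End FriendshipFactorization.

Theorem proposition3p27 (n : nat) (hn : (1 <= n)%N) : ~ MPF (friendship n).
Proof.
case/MPF_factorization => g [h fact]; have factC := factorizationC fact.
have mulc := degree_mul fact None; rewrite card_friendship_center in mulc.
have [p gp hcp] : exists2 p, g None (Some p) & #|h None| = #|h (Some p)|.
  by apply: (center_degree fact); case: #|g _| mulc; lia.
have [q hq gcq] : exists2 q, h None (Some q) & #|g None| = #|g (Some q)|.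
  by apply: (center_degree factC); case: #|h _| mulc; lia.
have cardV : #|{: option ('I_n * bool)}| = 2 * n + 1 := card_friendship n.
have addc := degree_add_lt fact None; rewrite cardV in addc.
have degp := rim_degrees fact p; have degq := rim_degrees fact q.
(* The centre cannot have degrees (1, 1), since 2n is even; degrees (1, 2) or
   (2, 1) would force n = 1 and contradict [addc]. *)
have [[gp1 hp2] [gq2 hq1]] : (#|g (Some p)| = 1 /\ #|h (Some p)| = 2) /\
                             (#|g (Some q)| = 2 /\ #|h (Some q)| = 1).
  move: mulc addc; rewrite hcp gcq.
  by case: degp degq => [[-> ->]|[-> ->]] [[-> ->]|[-> ->]]; lia.
have n2 : n = 2 by move: mulc; rewrite hcp gcq hp2 gq2; lia.
have := card_degree_class (Some p) fact; rewrite gp1 hp2.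
have := card_degree_class (Some q) factC; rewrite gq2 hq1.
set S := [pred v | #|h v| == 1]; set T := [pred v | #|g v| == 1] => cardS cardT.
have disST : [predI S & T] =i pred0.
  move=> v; rewrite !inE; apply/negP => /andP[/eqP hv /eqP gv].
  have := degree_mul fact v; rewrite hv gv.
  by case: v {hv gv} => [r|]; rewrite ?card_friendship_rim ?card_friendship_center;
     lia.
have := max_card [predU S & T]; rewrite cardV.
have := cardUI S T; rewrite (eq_card0 disST) addn0 => ->.
by apply/negP; rewrite -ltnNge; apply: leq_trans (leq_add cardS cardT); lia.
Qed.
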